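(* Let $n,m\ge 1$, $A\in\mathbb{R}^{n\times m}$, $\eta>0$, $T>0$ and $h(0)\in\mathbb{R}^m$. In the continuous-time zero-sum game in which the learner uses the Replicator Dynamics with parameter $\eta$ and initial historical rewards $h(0)$, the maximum $R^*_{cont}(h(0),T,A,-A)$ of the optimizer's total reward $R_{cont}(x,h(0),T,A,-A)$ over all strategies $x:[0,T]\to\Delta(\mathcal{A})$ is achieved by a constant strategy $x(t)=x^*\in\Delta(\mathcal{A})$ for all $t\in[0,T]$. Moreover $$R^*_{cont}(h(0),T,A,-A)=\max_{x\in\Delta(\mathcal{A})}\left\{\frac{\ln\left(\sum_{i=1}^m e^{\eta h_i(0)}\right)-\ln\left(\sum_{i=1}^m e^{\eta\left(h_i(0)-T e_i^\top A^\top x\right)}\right)}{\eta}\right\},$$ and $x^*$ is a maximizer of the right-hand side.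
   Context: Here $\Delta(\mathcal{A})\subset\mathbb{R}^n$ is the probability simplex over the optimizer's $n$ pure actions, and $e_1,\dots,e_m$ are the standard basis vectors of $\mathbb{R}^m$ (the learner's pure actions). $A$ is the optimizer's utility matrix and $B=-A$ is the learner's. A strategy of the optimizer is a (measurable) function $x:[0,T]\to\Delta(\mathcal{A})$. The learner, using the Replicator Dynamics with parameter $\eta$ and initial historical rewards $h(0)$, plays at time $t$ the mixed strategy $y(t)\in\mathbb{R}^m$ with $$y_i(t)=\frac{e^{\eta\left(h_i(0)-e_i^\top A^\top\int_0^t x(s)\,ds\right)}}{\sum_{j=1}^m e^{\eta\left(h_j(0)-e_j^\top A^\top\int_0^t x(s)\,ds\right)}},\qquad i=1,\dots,m.$$ The optimizer's total reward is $R_{cont}(x,h(0),T,A,-A)=\int_0^T x(t)^\top A\,y(t)\,dt$, and $R^*_{cont}(h(0),T,A,-A)=\max_x R_{cont}(x,h(0),T,A,-A)$. *)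

(* Defs.v *)
(* MathComp-Analysis: the real line is an arbitrary R : realType. *)
From HB Require Import structures.
From mathcomp Require Import all_boot all_order all_algebra.
From mathcomp Require Import all_classical all_reals all_analysis.
Set Implicit Arguments.
Unset Strict Implicit.
Unset Printing Implicit Defensive.
Import Order.TTheory GRing.Theory Num.Theory.
Import numFieldNormedType.Exports.
Local Open Scope classical_set_scope.
Local Open Scope ring_scope.

Definition simplex (R : realType) (n : nat) : set 'cV[R]_n :=
  [set x : 'cV[R]_n | (forall i, 0 <= x i 0) /\ \sum_i x i 0 = 1].
Arguments simplex R n : clear implicits.

(* Only the values on [0, T] are constrained; the strategy is represented by a
   function on all of R. Measurability of a vector-valued map is that of its
   coordinates. *)
Definition strategy (R : realType) (n : nat) (T : R) : set (R -> 'cV[R]_n) :=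
  [set x : R -> 'cV[R]_n |
    (forall i, measurable_fun `[0, T] (fun t => x t i 0)) /\
    (forall t, 0 <= t <= T -> simplex R n (x t))].
Arguments strategy {R} n T.

Definition strategy_integral (R : realType) (n : nat) (x : R -> 'cV[R]_n)
    (t : R) : 'cV[R]_n :=
  \col_i \int[lebesgue_measure]_(s in `[0, t]) x s i 0.

Definition std_basis (R : realType) (m : nat) (i : 'I_m) : 'cV[R]_m :=
  delta_mx i 0.
Arguments std_basis R {m} i.

(* The learner's utility matrix is - A, hence the minus sign. *)
Definition replicator (R : realType) (n m : nat) (eta : R) (h0 : 'cV[R]_m)
    (A : 'M[R]_(n, m)) (x : R -> 'cV[R]_n) (t : R) : 'cV[R]_m :=
  let w (i : 'I_m) : R :=
    expR (eta * (h0 i 0 -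
      ((std_basis R i)^T *m A^T *m strategy_integral x t) 0 0)) in
  \col_i (w i / \sum_j w j).

Definition Rcont (R : realType) (n m : nat) (eta : R) (h0 : 'cV[R]_m) (T : R)
    (A : 'M[R]_(n, m)) (x : R -> 'cV[R]_n) : R :=
  \int[lebesgue_measure]_(t in `[0, T])
    ((x t)^T *m A *m replicator eta h0 A x t) 0 0.

Definition maximizer (R : realType) (X : Type) (S : set X) (f : X -> R) (x : X)
    : Prop :=
  S x /\ forall y, S y -> f y <= f x.

(* A supremum, which is a maximum as soon as Rcont has a maximizer among the
   strategies. *)
Definition Rcont_star (R : realType) (n m : nat) (eta : R) (h0 : 'cV[R]_m)
    (T : R) (A : 'M[R]_(n, m)) : R :=
  sup [set Rcont eta h0 T A x | x in strategy n T].

Definition static_value (R : realType) (n m : nat) (eta : R) (h0 : 'cV[R]_m)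
    (T : R) (A : 'M[R]_(n, m)) (x : 'cV[R]_n) : R :=
  (ln (\sum_i expR (eta * h0 i 0)) -
   ln (\sum_i expR (eta * (h0 i 0 - T * ((std_basis R i)^T *m A^T *m x) 0 0)))) / eta.

(* Main.v *)
Require Import Defs.
From HB Require Import structures.
From mathcomp Require Import all_boot all_order all_algebra.
From mathcomp Require Import all_classical all_reals all_analysis.
From mathcomp Require Import measurable_realfun ring lra.
Set Implicit Arguments.
Unset Strict Implicit.
Unset Printing Implicit Defensive.
Import Order.TTheory GRing.Theory Num.Theory.
Import numFieldNormedType.Exports.
Local Open Scope classical_set_scope.
Local Open Scope ring_scope.

(** With [u_i(t) = eta (h_i(0) - e_i^T A^T X(t))], [X(t)] the integral of [x] over
    [[0, t]], the learner plays the softmax of [u(t)], which is the gradient of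
    [lse u = ln (\sum_i exp (u_i))].  The reward rate [x^T A y] is therefore
    [- 1 / eta] times the derivative of [lse (u(t))], so the total reward
    depends only on [X(T)] and equals the static value of the average
    strategy [X(T) / T], which is also the reward of playing that average all
    along.  As [x] is merely measurable, the chain rule fails at some times; it
    is replaced by an estimate: [lse (u(t))] and the integral of its formal
    derivative have increments on [[s, t]] differing by [O((t - s)^2)], by
    convexity of [lse] and Lipschitz continuity of the softmax. *)

(** * Log-sum-exp and softmax: convexity and Lipschitz bounds *)

Definition lse (R : realType) (m : nat) (u : 'I_m -> R) : R :=
  ln (\sum_i expR (u i)).

(* Free of division, so that its measurability is that of [expR] and [ln]. *)
Definition softmax (R : realType) (m : nat) (u : 'I_m -> R) (i : 'I_m) : R :=
  expR (u i - lse u).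

Section log_sum_exp.
Variables (R : realType) (m : nat).
Hypothesis m_gt0 : (0 < m)%N.
Implicit Types u v : 'I_m -> R.

Lemma sum_expR_gt0 u : 0 < \sum_i expR (u i).
Proof.
rewrite (bigD1 (Ordinal m_gt0))//= ltr_pwDl ?expR_gt0//.
by apply: sumr_ge0 => i _; exact: expR_ge0.
Qed.

Lemma expR_lse u : expR (lse u) = \sum_i expR (u i).
Proof. by rewrite /lse lnK// posrE sum_expR_gt0. Qed.

Lemma softmaxE u i : softmax u i = expR (u i) / \sum_j expR (u j).
Proof. by rewrite /softmax expRD expRN expR_lse. Qed.

Lemma sum_softmax u : \sum_i softmax u i = 1.
Proof.
under eq_bigr do rewrite softmaxE.
by rewrite -mulr_suml divff// gt_eqF// sum_expR_gt0.
Qed.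

Lemma softmax_le1 u i : softmax u i <= 1.
Proof.
rewrite -(sum_softmax u) (bigD1 i)//= lerDl.
by apply: sumr_ge0 => j _; exact: expR_ge0.
Qed.

Lemma lse_tangent u v :
  lse u + \sum_i softmax u i * (v i - u i) <= lse v.
Proof.
(* Jensen's inequality, by the tangent line of [expR] at the mean [c]. *)
set c := \sum_i _.
rewrite -ler_expR expR_lse.
have -> : expR (lse u + c) =
    \sum_i expR (lse u + c) * (softmax u i * (1 + (v i - u i - c))).
  rewrite -mulr_sumr; under eq_bigr do rewrite mulrDr mulr1 mulrBr.
  by rewrite big_split/= sumrB -mulr_suml sum_softmax mul1r subrr addr0 mulr1.
apply: ler_sum => i _.
have -> : expR (v i) =
    expR (lse u + c) * (softmax u i * expR (v i - u i - c)).
  by rewrite /softmax -!expRD; congr expR; ring.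
by rewrite !ler_pM2l ?expR_gt0// expR_ge1Dx.
Qed.

Lemma lse_increment_ge u v : \sum_i softmax u i * (v i - u i) <= lse v - lse u.
Proof. by rewrite lerBrDl lse_tangent. Qed.

(** The tangent inequality with [u] and [v] exchanged. With [lse_increment_ge] it encloses an
    increment of [lse] between its linearizations at the two ends, without any derivative being
    taken. *)
Lemma lse_increment_le u v : lse v - lse u <= \sum_i softmax v i * (v i - u i).
Proof.
rewrite -lerN2 opprB -sumrN; apply: le_trans (lse_increment_ge v u).
by apply: ler_sum => i _; rewrite -mulrN opprB.
Qed.

(** The gradient of [lse] is a probability vector, so its pairing with a displacement is at most the
    sup norm of the latter. *)
Lemma lse_lipschitz u v (e : R) :
  (forall i, `|v i - u i| <= e) -> lse u - lse v <= e.
Proof.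
move=> uv; apply: le_trans (lse_increment_le v u) _.
rewrite -[e]mul1r -(sum_softmax u) mulr_suml.
apply: ler_sum => i _; rewrite ler_pM2l ?expR_gt0//.
by apply: le_trans (ler_norm _) _; rewrite distrC.
Qed.

(** Passing from [u] to [v] multiplies the weight by the exponential of a number at least [- 2 * e]:
    one [e] from the coordinate, one from [lse]. The bound then follows from [1 + z <= expR z] and
    from the weight being at most 1. *)
Let softmax_shift u v (e : R) i : 0 <= e ->
  (forall i, `|v i - u i| <= e) -> softmax u i - softmax v i <= 2 * e.
Proof.
move=> e0 uv.
have -> : softmax v i = softmax u i * expR ((v i - u i) + (lse u - lse v)).
  by rewrite /softmax -!expRD; congr expR; ring.
have vu j : `|u j - v j| <= e by rewrite distrC.
have h1 := lse_lipschitz vu.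
have h2 : 1 - 2 * e <= expR (v i - u i + (lse u - lse v)).
  apply: le_trans (expR_ge1Dx _).
  have := uv i; rewrite ler_norml => /andP[? ?]; lra.
have h3 : 0 <= softmax u i by exact: expR_ge0.
have h4 := softmax_le1 u i.
by have h5 := ler_wpM2l h3 h2; nra.
Qed.

Lemma softmax_lipschitz u v (e : R) i :
  (forall i, `|v i - u i| <= e) -> `|softmax u i - softmax v i| <= 2 * e.
Proof.
move=> uv; have e0 : 0 <= e by exact: le_trans (uv i).
rewrite ler_norml softmax_shift// andbT lerNl opprB.
by apply: softmax_shift => // j; rewrite distrC.
Qed.

End log_sum_exp.

(** * Enclosures and quadratically small increments *)

Lemma dist_between (R : realDomainType) (p a q z e : R) :
  p <= a -> a <= q -> `|z - p| <= e -> `|z - q| <= e -> `|a - z| <= e.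
Proof.
rewrite !ler_norml => ? ? /andP[? ?] /andP[? ?].
by apply/andP; split; lra.
Qed.

(** Over [N] equal pieces of the interval the increments add up to at most [K * T ^+ 2 / N], which
    is arbitrarily small. *)
Lemma quadratic_increments_const (R : realType) (D : R -> R) (K T : R) :
  0 <= T ->
  (forall s t, 0 <= s -> s <= t -> t <= T -> `|D t - D s| <= K * (t - s) ^+ 2) ->
  D T = D 0.
Proof.
move=> T0 DK; apply/eqP; rewrite -subr_eq0 -normr_le0.
have step (N : nat) : (0 < N)%N -> `|D T - D 0| <= K * T ^+ 2 / N%:R.
  move=> N0; have N0' : 0 < N%:R :> R by rewrite ltr0n.
  pose p k := k%:R * (T / N%:R).
  have q0 : 0 <= T / N%:R by rewrite divr_ge0// ltW.
  have -> : D T - D 0 = \sum_(0 <= k < N) (D (p k.+1) - D (p k)).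
    by rewrite telescope_sumr// /p mul0r mulrCA divff ?mulr1// gt_eqF.
  apply: le_trans (ler_norm_sum _ _ _) _.
  have -> : K * T ^+ 2 / N%:R = \sum_(0 <= k < N) K * (T / N%:R) ^+ 2.
    rewrite sumr_const_nat subn0 -mulr_natr.
    by field; rewrite gt_eqF.
  rewrite big_nat [leRHS]big_nat; apply: ler_sum => k /andP[_ kN].
  have pS : p k.+1 - p k = T / N%:R by rewrite /p -mulrBl -natrB// subSnn mul1r.
  rewrite -pS; apply: DK.
  - by rewrite mulr_ge0.
  - by rewrite -subr_ge0 pS.
  - rewrite /p mulrCA -[leRHS]mulr1 ler_wpM2l// ler_pdivrMr// mul1r ler_nat; exact: kN.
apply/ler_addgt0Pl => e e0; rewrite addr0.
have [KT|KT] := leP (K * T ^+ 2) 0.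
  by apply: le_trans (step 1 isT) _; rewrite divr1 (le_trans KT)// ltW.
(* The least natural number above [K * T ^+ 2 / e], so that the bound of [step] falls below [e]. *)
pose N := (Num.truncn (K * T ^+ 2 / e)).+1.
apply: le_trans (step N isT) _.
rewrite ler_pdivrMr ?ltr0n// -ler_pdivrMl// mulrC.
exact: ltW (truncnS_gt (K * T ^+ 2 / e)).
Qed.

(** * Integrals of bounded measurable functions over intervals *)

Section bounded_integrals.
Variables (R : realType) (T : R).
Notation mu := (@lebesgue_measure R).
Implicit Types (f : R -> R) (M s t : R).

Lemma bounded_itv_integrable f M : measurable_fun `[0, T] f ->
  (forall t, 0 <= t <= T -> `|f t| <= M) -> mu.-integrable `[0, T] (EFin \o f).
Proof.
move=> mf fM; apply: measurable_bounded_integrable => //.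
  by rewrite /= lebesgue_measure_itv/=; case: ifP => _; rewrite ?ltry// -EFinD ltry.
exists M; split; first exact: num_real.
move=> N MN t /=; rewrite in_itv/= => tT; exact: le_trans (fM t tT) (ltW MN).
Qed.

Lemma subitv_integrable f s t : 0 <= s -> t <= T ->
  mu.-integrable `[0, T] (EFin \o f) -> mu.-integrable `]s, t] (EFin \o f).
Proof.
move=> s0 tT; apply: integrableS => //= r /=; rewrite !in_itv/= => /andP[sr rt].
by rewrite (le_trans s0 (ltW sr)) (le_trans rt tT).
Qed.

Lemma Rintegral_itv_increment f s t : 0 <= s -> s <= t -> t <= T ->
  mu.-integrable `[0, T] (EFin \o f) ->
  \int[mu]_(r in `[0, t]) f r - \int[mu]_(r in `[0, s]) f r =
  \int[mu]_(r in `]s, t]) f r.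
Proof.
move=> s0 st tT itf; apply: Rintegral_itvB; rewrite ?bnd_simp//.
by apply: integrableS itf => //; apply: subset_itvl; rewrite bnd_simp.
Qed.

Lemma Rintegral_itv_bound f M s t : 0 <= s -> s <= t -> t <= T ->
  mu.-integrable `[0, T] (EFin \o f) ->
  (forall r, s <= r <= t -> `|f r| <= M) ->
  `|\int[mu]_(r in `]s, t]) f r| <= M * (t - s).
Proof.
move=> s0 st tT itf fM; have itf' := subitv_integrable s0 tT itf.
apply: le_trans (le_normr_Rintegral _ itf') _ => //.
have -> : M * (t - s) = \int[mu]_(r in `]s, t]) M.
  rewrite Rintegral_cst//= lebesgue_measure_itv/= lte_fin.
  by case: ltP => [//|ts]; rewrite (_ : t = s) ?subrr//; apply/le_anti/andP.
apply: le_Rintegral => //.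
- by have := integrable_norm itf'; apply.
- apply: measurable_bounded_integrable => //.
    by rewrite /= lebesgue_measure_itv/=; case: ifP => _; rewrite ?ltry// -EFinD ltry.
  exists `|M|; split; first exact: num_real.
  by move=> N MN r _; exact: ltW.
- move=> r /=; rewrite in_itv/= => /andP[sr rt].
  by apply: fM; rewrite (ltW sr).
Qed.

(** Integrability is carried through the induction together with the value, since additivity at each
    step requires it for the tail. *)
Lemma Rintegral_sum (I : Type) (l : seq I) (F : I -> R -> R) (D : set R) :
  measurable D -> (forall i, mu.-integrable D (EFin \o F i)) ->
  mu.-integrable D (EFin \o (fun t => \sum_(i <- l) F i t)) /\
  \int[mu]_(t in D) (\sum_(i <- l) F i t) =
    \sum_(i <- l) \int[mu]_(t in D) F i t.
Proof.
move=> mD iF; elim: l => [|i l [ih1 ih2]].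
  split.
    under [X in _.-integrable _ X]eq_fun do rewrite /= big_nil.
    exact: integrable0.
  under eq_Rintegral do rewrite big_nil.
  by rewrite big_nil Rintegral_cst// mul0r.
split.
  have -> : EFin \o (fun t => \sum_(j <- i :: l) F j t) =
      (EFin \o F i) \+ (EFin \o (fun t => \sum_(j <- l) F j t)).
    by apply/funext => t /=; rewrite big_cons EFinD.
  exact: integrableD.
under eq_Rintegral do rewrite big_cons.
by rewrite RintegralD// ih2 big_cons.
Qed.

End bounded_integrals.

(** * Fundamental theorem of calculus for [lse] along a Lipschitz path *)

Section lse_fundamental_theorem.
Variables (R : realType) (m : nat) (T M : R) (g : 'I_m -> R -> R) (c : 'I_m -> R).
Hypotheses (m_gt0 : (0 < m)%N) (T_ge0 : 0 <= T).
Hypothesis mg : forall i, measurable_fun `[0, T] (g i).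
Hypothesis gM : forall i t, 0 <= t <= T -> `|g i t| <= M.
Notation mu := (@lebesgue_measure R).

(** The path starting at [c] with formal derivative [g]; in the game it is the vector of exponents
    of the learner. *)
Let u t i := c i + \int[mu]_(s in `[0, t]) g i s.

Let M_ge0 : 0 <= M.
Proof. by apply: le_trans (gM (Ordinal m_gt0) (t := 0) _); rewrite ?lexx. Qed.

Let ig i : mu.-integrable `[0, T] (EFin \o g i).
Proof. by apply: bounded_itv_integrable (mg i) _ => t; exact: gM. Qed.

Let u_increment i s t : 0 <= s -> s <= t -> t <= T ->
  u t i - u s i = \int[mu]_(r in `]s, t]) g i r.
Proof.
move=> s0 st tT; rewrite -(Rintegral_itv_increment s0 st tT (ig i)) /u; ring.
Qed.

Let u_lipschitz i s t : 0 <= s -> s <= t -> t <= T ->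
  `|u t i - u s i| <= M * (t - s).
Proof.
move=> s0 st tT; rewrite u_increment//.
apply: Rintegral_itv_bound (ig i) _ => // r /andP[sr rt].
by apply: gM; rewrite (le_trans s0 sr) (le_trans rt tT).
Qed.

Let measurable_u i : measurable_fun `[0, T] (fun t => u t i).
Proof.
apply: measurable_funD => //; apply: subspace_continuous_measurable_fun => //.
exact: parameterized_integral_continuous.
Qed.

Let measurable_softmax i : measurable_fun `[0, T] (fun t => softmax (u t) i).
Proof.
rewrite /softmax /lse; apply: measurableT_comp => //.
apply: measurable_funB => //; apply: measurableT_comp => //.
by apply: measurable_sum => j; exact: measurableT_comp (measurable_u j).
Qed.

(** What the chain rule would give as the derivative of [lse (u t)]. *)
Let f t := \sum_i g i t * softmax (u t) i.

Let igs i : mu.-integrable `[0, T] (EFin \o (fun t => g i t * softmax (u t) i)).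
Proof.
apply: (@bounded_itv_integrable _ _ _ M); first exact: measurable_funM.
move=> t tT; rewrite normrM (ger0_norm (expR_ge0 _)) -[M]mulr1.
by apply: ler_pM => //; rewrite ?expR_ge0 ?gM// softmax_le1.
Qed.

Lemma integrable_softmax_mean : mu.-integrable `[0, T]
  (EFin \o (fun t => \sum_i g i t * softmax (u t) i)).
Proof. by have [] := Rintegral_sum (index_enum 'I_m) (measurable_itv _) igs. Qed.

(** On [[s, t]] the path moves by at most [M * (t - s)], hence each softmax weight by at most twice
    that. Multiplying by the bound [M] on [g] and by the length [t - s] gives
    [2 * M ^+ 2 * (t - s) ^+ 2] for each of the [m] coordinates. The base point [r] is left free so
    that both ends can be taken. *)
Let linearization_error r s t : 0 <= s -> s <= r -> r <= t -> t <= T ->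
  `|\int[mu]_(q in `]s, t]) f q - \sum_i softmax (u r) i * (u t i - u s i)|
  <= m%:R * (2 * M ^+ 2) * (t - s) ^+ 2.
Proof.
move=> s0 sr rt tT; have st := le_trans sr rt.
have ig' i := subitv_integrable s0 tT (ig i).
have igs' i := subitv_integrable s0 tT (igs i).
have [_ ->] := Rintegral_sum (index_enum 'I_m) (measurable_itv `]s, t]) igs'.
rewrite -sumrB; apply: le_trans (ler_norm_sum _ _ _) _.
have -> : m%:R * (2 * M ^+ 2) * (t - s) ^+ 2 =
    \sum_(i < m) (2 * M ^+ 2) * (t - s) ^+ 2.
  by rewrite sumr_const card_ord -[RHS]mulr_natl -mulrA.
apply: ler_sum => i _; rewrite u_increment// -RintegralZl//.
have iZ : mu.-integrable `[0, T] (EFin \o (fun q => softmax (u r) i * g i q)).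
  exact: (integrableZl _ (softmax (u r) i) (ig i)).
pose F q := g i q * softmax (u q) i; pose G q := softmax (u r) i * g i q.
have iB : mu.-integrable `[0, T] (EFin \o (fun q => F q - G q)).
  have -> : EFin \o (fun q => F q - G q) = ((EFin \o F) \- (EFin \o G))%E.
    exact/funext.
  by apply: integrableB; [exact: measurable_itv|exact: igs|exact: iZ].
rewrite -RintegralB//; last exact: subitv_integrable iZ.
rewrite expr2 [leRHS]mulrA.
apply: (Rintegral_itv_bound s0 st tT iB) => q /andP[sq qt].
rewrite /F /G [softmax (u r) i * _]mulrC -mulrBr.
have -> : 2 * M ^+ 2 * (t - s) = M * (2 * (M * (t - s))) by ring.
rewrite normrM ler_pM//.
  by apply: gM; rewrite (le_trans s0 sq) (le_trans qt tT).
apply: softmax_lipschitz => // j; have [qr|rq] := leP q r.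
- apply: le_trans (u_lipschitz _ _ _ _) _ => //.
  + exact: le_trans sq.
  + exact: le_trans rt tT.
  + by rewrite ler_wpM2l// lerB.
- rewrite distrC; apply: le_trans (u_lipschitz _ _ _ _) _ => //.
  + exact: le_trans sr.
  + exact: ltW.
  + exact: le_trans qt tT.
  + by rewrite ler_wpM2l// lerB.
Qed.

Lemma lse_Rintegral :
  \int[mu]_(t in `[0, T]) (\sum_i g i t * softmax (u t) i) = lse (u T) - lse c.
Proof.
pose D t := lse (u t) - \int[mu]_(r in `[0, t]) f r.
have u0 : u 0 = c.
  by apply/funext => i; rewrite /u set_itv1 Rintegral_set1 addr0.
have : D T = D 0.
  apply: (@quadratic_increments_const _ _ (m%:R * (2 * M ^+ 2))) => //.
  move=> s t s0 st tT.
  have -> : D t - D s =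
      lse (u t) - lse (u s) - \int[mu]_(r in `]s, t]) f r.
    rewrite -(Rintegral_itv_increment s0 st tT integrable_softmax_mean) /D !opprB addrACA.
    by rewrite [RHS]addrACA [X in _ = _ + X]addrC.
  (* Convexity puts the increment of [lse] between its linearizations at [s] and at [t]; each of
     these is within the linearization error of the integral. *)
  apply: (dist_between (lse_increment_ge m_gt0 (u s) (u t))
                       (lse_increment_le m_gt0 (u s) (u t))).
  - exact: linearization_error s0 (lexx s) st tT.
  - exact: linearization_error s0 st (lexx t) tT.
rewrite /D u0 set_itv1 Rintegral_set1 subr0 => DT.
by rewrite -DT subKr.
Qed.

End lse_fundamental_theorem.

(** * Reward of a strategy and of its time average *)

Section game.
Variables (R : realType) (n m : nat) (A : 'M[R]_(n, m)) (eta T : R).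
Variable h0 : 'cV[R]_m.
Hypotheses (m_gt0 : (0 < m)%N) (eta_gt0 : 0 < eta) (T_gt0 : 0 < T).
Notation mu := (@lebesgue_measure R).
Implicit Types (x : R -> 'cV[R]_n) (v : 'cV[R]_n).

Lemma payoffE v i :
  ((std_basis R i)^T *m A^T *m v) 0 0 = \sum_k A k i * v k 0.
Proof. by rewrite mxE; apply: eq_bigr => k _; rewrite -trmx_mul -colE !mxE. Qed.

Lemma static_valueE v : static_value eta h0 T A v =
  (lse (fun i => eta * h0 i 0) -
   lse (fun i => eta * (h0 i 0 - T * \sum_k A k i * v k 0))) / eta.
Proof.
rewrite /static_value /lse; congr ((_ - ln _) / _).
by apply: eq_bigr => i _; rewrite payoffE.
Qed.

Lemma simplex_entry_le1 v k : simplex R n v -> `|v k 0| <= 1.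
Proof.
move=> [v0 v1]; rewrite ger0_norm// -v1 (bigD1 k)//= lerDl.
exact: sumr_ge0.
Qed.

Section play.
Variable x : R -> 'cV[R]_n.
Hypothesis x_strategy : strategy n T x.

Let integrable_x k : mu.-integrable `[0, T] (EFin \o (fun t => x t k 0)).
Proof.
apply: (@bounded_itv_integrable _ _ _ 1); first exact: x_strategy.1.
by move=> t tT; exact/simplex_entry_le1/x_strategy.2.
Qed.

Let g i t := - eta * \sum_k A k i * x t k 0.
Let c i := eta * h0 i 0.
(** Entries of [x t] are at most 1 in absolute value; summing over all [i] makes the bound on [g]
    uniform in the coordinate. *)
Let M := eta * \sum_i \sum_k `|A k i|.

Let measurable_g i : measurable_fun `[0, T] (g i).
Proof.
apply: measurable_funM => //; apply: measurable_sum => k.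
by apply: measurable_funM => //; exact: x_strategy.1.
Qed.

Let g_bounded i t : 0 <= t <= T -> `|g i t| <= M.
Proof.
move=> tT; rewrite normrM normrN (gtr0_norm eta_gt0) ler_pM2l//.
apply: le_trans (ler_norm_sum _ _ _) _; rewrite (bigD1 i)//= -[leLHS]addr0.
apply: lerD; last by apply: sumr_ge0 => j _; exact: sumr_ge0.
apply: ler_sum => k _; rewrite normrM -[leRHS]mulr1 ler_wpM2l//.
exact/simplex_entry_le1/x_strategy.2.
Qed.

(** Identifies the path of the preceding section with the exponents occurring in [replicator]. *)
Let integral_g i t : 0 <= t <= T ->
  c i + \int[mu]_(s in `[0, t]) g i s =
  eta * (h0 i 0 - \sum_k A k i * strategy_integral x t k 0).
Proof.
move=> /andP[t0 tT].
have ix k : mu.-integrable `[0, t] (EFin \o (fun s => x s k 0)).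
  by apply: integrableS (integrable_x k) => //; apply: subset_itvl; rewrite bnd_simp.
have iAx k : mu.-integrable `[0, t] (EFin \o (fun s => A k i * x s k 0)).
  exact: (integrableZl _ (A k i) (ix k)).
have [iS IS] := Rintegral_sum (index_enum 'I_n) (measurable_itv `[0, t]) iAx.
rewrite RintegralZl// IS /c mulNr mulrBr; congr (_ - _ * _).
by apply: eq_bigr => k _; rewrite RintegralZl// mxE.
Qed.

Let average : 'cV[R]_n := T^-1 *: strategy_integral x T.

Lemma Rcont_average : Rcont eta h0 T A x = static_value eta h0 T A average.
Proof.
have FTC := lse_Rintegral c m_gt0 (ltW T_gt0) measurable_g g_bounded.
have itg := integrable_softmax_mean c m_gt0 (ltW T_gt0) measurable_g g_bounded.
(* At each time of the interval, [replicator] is the softmax of the path, and coordinate [i] of the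
   row [x^T A] is [- eta^-1 * g i t]. *)
transitivity (- eta^-1 * \int[mu]_(t in `[0, T])
    \sum_i g i t * softmax (fun i => c i + \int[mu]_(s in `[0, t]) g i s) i).
  rewrite -RintegralZl//; apply: eq_Rintegral => t; rewrite inE/= in_itv/= => tT.
  rewrite mxE mulr_sumr; apply: eq_bigr => i _; rewrite mulrA; congr (_ * _).
    rewrite /g mulrA mulrNN mulVf ?gt_eqF// mul1r mxE.
    by apply: eq_bigr => k _; rewrite mxE mulrC.
  rewrite softmaxE// mxE integral_g// payoffE; congr (_ / _).
  by apply: eq_bigr => j _; rewrite integral_g// payoffE.
rewrite FTC static_valueE mulNr -mulrN opprB mulrC; congr ((_ - lse _) / _).
apply/funext => i; rewrite integral_g ?lexx ?ltW//; congr (_ * (_ - _)).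
rewrite mulr_sumr; apply: eq_bigr => k _.
by rewrite [in RHS]mxE mulrCA (mulrA T) divff ?gt_eqF// mul1r.
Qed.

(** The coordinates sum to 1 at every time, so their integrals sum to [T]. *)
Lemma simplex_average : simplex R n average.
Proof.
split=> [k|].
  rewrite !mxE mulr_ge0 ?invr_ge0 ?(ltW T_gt0)//; apply: Rintegral_ge0 => t.
  by rewrite /= in_itv/= => /x_strategy.2[].
under eq_bigr do rewrite !mxE.
rewrite -mulr_sumr.
have [_ <-] := Rintegral_sum (index_enum 'I_n) (measurable_itv `[0, T]) integrable_x.
transitivity (T^-1 * \int[mu]_(t in `[0, T]) (1 : R)).
  congr (_ * _); apply: eq_Rintegral => t; rewrite inE/= in_itv/= => tT.
  by have [] := x_strategy.2 t tT.
by rewrite Rintegral_cst//= lebesgue_measure_itv/= lte_fin T_gt0 mul1r/= subr0 mulVf ?gt_eqF.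
Qed.

End play.

Lemma strategy_cst v : simplex R n v -> strategy n T (fun=> v).
Proof. by move=> v_simplex; split. Qed.

(** A constant strategy is its own average. *)
Lemma Rcont_cst v : simplex R n v ->
  Rcont eta h0 T A (fun=> v) = static_value eta h0 T A v.
Proof.
move=> v_simplex; rewrite (Rcont_average (strategy_cst v_simplex)).
congr static_value; apply/colP => k; rewrite !mxE Rintegral_cst//=.
rewrite lebesgue_measure_itv/= lte_fin T_gt0/= subr0.
by rewrite mulrC mulfK ?gt_eqF.
Qed.

(** Averages give one inclusion and constant strategies the other; the two suprema of the theorem
    are thus taken over the same set. *)
Lemma image_Rcont :
  [set Rcont eta h0 T A x | x in strategy n T] =
  [set static_value eta h0 T A v | v in simplex R n].
Proof.
apply/seteqP; split=> _ [y y_in <-].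
  by rewrite Rcont_average//; exists (T^-1 *: strategy_integral y T) => //;
    exact: simplex_average.
by rewrite -Rcont_cst//; exists (fun=> y) => //; exact: strategy_cst.
Qed.

(** * Existence of a best static strategy by compactness *)

Lemma compact_simplex_row : compact [set r : 'rV[R]_n | simplex R n r^T].
Proof.
(* The simplex is a closed subset of the unit cube. Rows replace columns here because [rV_compact]
   concerns row vectors. *)
have cube_compact := @rV_compact R n (fun=> `[0, 1]%classic)
  (fun=> @segment_compact R 0 1).
apply: subclosed_compact cube_compact _.
- have -> : [set r : 'rV[R]_n | simplex R n r^T] =
      (\bigcap_(i in [set: 'I_n]) [set r : 'rV[R]_n | 0 <= r 0 i]) `&`
      [set r : 'rV[R]_n | \sum_i r 0 i = 1].
    apply/seteqP; split=> r /=.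
      case=> r0 r1; split=> [i _/=|]; first by have := r0 i; rewrite mxE.
      by rewrite -r1; apply: eq_bigr => i _; rewrite mxE.
    case=> r0 r1; split=> [i|]; first by rewrite mxE; exact: r0.
    by rewrite -r1; apply: eq_bigr => i _; rewrite mxE.
  apply: closedI.
    apply: closed_bigI => i _.
    apply: (@preimage_closed _ _ (fun r : 'rV[R]_n => r 0 i) [set y | 0 <= y]).
      by move=> r _; exact: coord_continuous.
    exact: closed_ge.
  apply: (@preimage_closed _ _ (fun r : 'rV[R]_n => \sum_i r 0 i) [set y | y = 1]).
    move=> r _; apply: (cvg_big add_continuous) => [|i _]; first exact: nbhs_filter. exact: coord_continuous.
  exact: closed_eq.
- move=> r r_simplex i /=; rewrite in_itv/=.
  have := simplex_entry_le1 i r_simplex; have := r_simplex.1 i.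
  by rewrite mxE => r0; rewrite r0 (ger0_norm r0).
Qed.

Lemma continuous_static_value :
  continuous (fun r : 'rV[R]_n => static_value eta h0 T A r^T).
Proof.
(* The static value depends on its argument through the coordinates alone, so coordinatewise
   continuity of the parametrization [f] suffices; transposition is then one instance. *)
suff cont (U : topologicalType) (f : U -> 'cV[R]_n) :
    (forall k, continuous (fun r => f r k 0)) ->
    continuous (fun r => static_value eta h0 T A (f r)).
  apply: cont => k; rewrite (funext (fun r => mxE _ _ k 0)).
  exact: coord_continuous.
move=> f_cont; rewrite (funext (fun r : U => static_valueE (f r))) => r.
apply: cvgM; last exact: cvg_cst.
apply: cvgB; first exact: cvg_cst.
apply: continuous_comp; last exact/continuous_ln/sum_expR_gt0.
apply: (cvg_big add_continuous) => i _.
apply: continuous_comp; last exact: continuous_expR.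
apply: cvgM; first exact: cvg_cst.
apply: cvgB; first exact: cvg_cst.
apply: cvgM; first exact: cvg_cst.
apply: (cvg_big add_continuous) => k _.
by apply: cvgM; [exact: cvg_cst|exact: f_cont].
Qed.

Lemma static_value_maximizer : (0 < n)%N ->
  exists v, maximizer (simplex R n) (static_value eta h0 T A) v.
Proof.
move=> n_gt0.
have [|r] := compact_EVT_max _ compact_simplex_row
  (continuous_subspaceT continuous_static_value).
  (* A vertex shows that the simplex is nonempty, as the extreme value theorem requires. *)
  pose r0 : 'rV[R]_n := delta_mx 0 (Ordinal n_gt0).
  exists r0; split=> [i|]; first by rewrite !mxE ler0n.
  rewrite (bigD1 (Ordinal n_gt0))//= big1 ?addr0; first by rewrite !mxE !eqxx.
  by move=> i /negPf ni; rewrite !mxE ni andbF.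
rewrite inE /= => r_simplex r_max; exists r^T; split=> // v v_simplex.
by have := r_max v^T; rewrite inE/= trmxK; exact.
Qed.

End game.

Theorem theorem3 (R : realType) (n m : nat) (A : 'M[R]_(n, m)) (eta T : R)
    (h0 : 'cV[R]_m)
    (hn : (1 <= n)%N) (hm : (1 <= m)%N) (heta : 0 < eta) (hT : 0 < T) :
  exists xs : 'cV[R]_n,
    [/\ maximizer (strategy n T) (Rcont eta h0 T A) (fun _ : R => xs),
        maximizer (simplex R n) (static_value eta h0 T A) xs &
        Rcont_star eta h0 T A =
          sup [set static_value eta h0 T A x | x in simplex R n]].
Proof.
have [xs [xs_simplex xs_max]] := static_value_maximizer A eta T h0 hm hn.
exists xs; split; [split=> [|x x_strategy]|by split|].
- exact: strategy_cst.
(* Any strategy earns the static value of its average, a point of the simplex, where [xs] is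
   optimal. *)
- rewrite Rcont_cst// Rcont_average//; apply: xs_max.
  exact: simplex_average x_strategy.
- by rewrite /Rcont_star image_Rcont.
Qed.
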